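(* Let $G\in\mathcal{R}$. (1) If $G\in\mathcal{C}$, then $G$ is not complementary vanishing. (2) If $G\notin\mathcal{C}$ and $G\in\mathcal{D}$, then $G$ is $\beta$-robust but not $\alpha$-robust. (3) If $G\notin\mathcal{C}$ and $\overline{G}\in\mathcal{D}$, then $G$ is $\alpha$-robust but not $\beta$-robust. (4) If $G\notin\mathcal{C}$ and $G,\overline{G}\notin\mathcal{D}$, then $G$ is both $\alpha$-robust and $\beta$-robust.
   Context: For a graph $G$ with vertex set $\{v_1,\dots,v_n\}$, $\mathcal{S}(G)$ is the set of real symmetric $n\times n$ matrices $A=[a_{i,j}]$ such that for $i\neq j$, $a_{i,j}\neq 0$ if and only if $v_iv_j\in E(G)$ (diagonal entries are unrestricted). $\overline{G}$ is the complement of $G$. $G$ is complementary vanishing if there exist $A\in\mathcal{S}(G)$, $B\in\mathcal{S}(\overline{G})$ with $AB=O$; it is $\alpha$-robust (resp. $\beta$-robust) if there exist such $A,B$ with $AB=O$ and $\ker(A)$ (resp. $\ker(B)$) containing a vector with all entries nonzero. $\mathcal{M}$ is the set of complementary vanishing graphs $G$ with $G$ and $\overline{G}$ both connected; $\mathcal{R}$ is the smallest set of graphs containing $\mathcal{M}$ closed under disjoint unions, joins (disjoint union plus all edges between the parts) and complements. $\mathcal{D}\subseteq\mathcal{R}$ is the set of graphs in $\mathcal{R}$ containing a leaf adjacent to a vertex of degree at least $2$. $\mathcal{C}$ is the set of graphs $G$ such that in $G$ or in $\overline{G}$ (neighborhoods taken in that graph) there exist distinct vertices $u,v,w$ with $v,w\notin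 N(u)$, $|N(u)\setminus N(w)|=1$ and $|N(u)\setminus N(v)|=0$, $N(x)$ being the open neighborhood. *)

(* Defs.v *)
From mathcomp Require Import all_boot all_order all_algebra.
From mathcomp Require Import reals.

Set Implicit Arguments.
Unset Strict Implicit.
Unset Printing Implicit Defensive.

Import GRing.Theory.
Local Open Scope ring_scope.

Record sgraph (n : nat) := SGraph {
  adj : rel 'I_n;
  adj_sym : symmetric adj;
  adj_irr : irreflexive adj
}.

Definition compl_rel n (G : sgraph n) : rel 'I_n :=
  fun i j => (i != j) && ~~ adj G i j.

Fact compl_rel_sym n (G : sgraph n) : symmetric (compl_rel G).
Proof. by move=> i j; rewrite /compl_rel eq_sym adj_sym. Qed.

Fact compl_rel_irr n (G : sgraph n) : irreflexive (compl_rel G).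
Proof. by move=> i; rewrite /compl_rel eqxx. Qed.

Definition compl n (G : sgraph n) : sgraph n :=
  SGraph (@compl_rel_sym n G) (@compl_rel_irr n G).

(* The union and the join live on 'I_(m + n): [split] sends the first m
   vertices to G and the last n to H. The boolean b tells whether vertices in
   different parts are adjacent. *)
Definition sum_rel (b : bool) m n (G : sgraph m) (H : sgraph n) :
    rel 'I_(m + n) :=
  fun i j => match split i, split j with
             | inl x, inl y => adj G x y
             | inr x, inr y => adj H x y
             | _, _ => b
             end.

Fact sum_rel_sym b m n (G : sgraph m) (H : sgraph n) :
  symmetric (sum_rel b G H).
Proof.
by move=> i j; rewrite /sum_rel; case: (split i) (split j) => x [y|y] //;
  rewrite adj_sym.
Qed.

Fact sum_rel_irr b m n (G : sgraph m) (H : sgraph n) :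
  irreflexive (sum_rel b G H).
Proof. by move=> i; rewrite /sum_rel; case: (split i) => x; rewrite adj_irr. Qed.

Definition disj_union m n (G : sgraph m) (H : sgraph n) : sgraph (m + n) :=
  SGraph (@sum_rel_sym false m n G H) (@sum_rel_irr false m n G H).

Definition join m n (G : sgraph m) (H : sgraph n) : sgraph (m + n) :=
  SGraph (@sum_rel_sym true m n G H) (@sum_rel_irr true m n G H).

Definition isomorphic m n (G : sgraph m) (H : sgraph n) : Prop :=
  exists2 f : 'I_m -> 'I_n, bijective f &
    forall i j, adj H (f i) (f j) = adj G i j.

Definition connected_graph n (G : sgraph n) : Prop :=
  (0 < n)%N /\ forall i j : 'I_n, connect (adj G) i j.

Definition nbhd n (G : sgraph n) (u : 'I_n) : {set 'I_n} :=
  [set x | adj G u x].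

Definition degree n (G : sgraph n) (u : 'I_n) : nat := #|nbhd G u|.

Section Robustness.

Variable R : realType.

Definition in_S n (G : sgraph n) (A : 'M[R]_n) : Prop :=
  A^T = A /\ forall i j, i != j -> (A i j != 0 <-> adj G i j).

Definition ker_has_nowhere_zero n (A : 'M[R]_n) : Prop :=
  exists2 x : 'cV[R]_n, A *m x = 0 & forall i, x i 0 != 0.

Definition compl_vanishing n (G : sgraph n) : Prop :=
  exists A B : 'M[R]_n, [/\ in_S G A, in_S (compl G) B & A *m B = 0].

Definition alpha_robust n (G : sgraph n) : Prop :=
  exists A B : 'M[R]_n,
    [/\ in_S G A, in_S (compl G) B, A *m B = 0 & ker_has_nowhere_zero A].

Definition beta_robust n (G : sgraph n) : Prop :=
  exists A B : 'M[R]_n,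
    [/\ in_S G A, in_S (compl G) B, A *m B = 0 & ker_has_nowhere_zero B].

Definition in_calM n (G : sgraph n) : Prop :=
  [/\ compl_vanishing G, connected_graph G & connected_graph (compl G)].

(* Sets of graphs are understood up to isomorphism. Here [calR_iso] is needed
   because [disj_union] and [join] only produce graphs whose two parts are
   initial and final segments of 'I_(m + n). *)
Inductive in_calR : forall n, sgraph n -> Prop :=
  | calR_M n (G : sgraph n) : in_calM G -> in_calR G
  | calR_union m n (G : sgraph m) (H : sgraph n) :
      in_calR G -> in_calR H -> in_calR (disj_union G H)
  | calR_join m n (G : sgraph m) (H : sgraph n) :
      in_calR G -> in_calR H -> in_calR (join G H)
  | calR_compl n (G : sgraph n) : in_calR G -> in_calR (compl G)
  | calR_iso m n (G : sgraph m) (H : sgraph n) :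
      isomorphic G H -> in_calR G -> in_calR H.

Definition in_calD n (G : sgraph n) : Prop :=
  in_calR G /\
  exists l v : 'I_n, [/\ degree G l = 1%N, adj G l v & (2 <= degree G v)%N].

End Robustness.

Definition C_witness n (G : sgraph n) : Prop :=
  exists u v w : 'I_n,
    [/\ [/\ u != v, u != w & v != w],
        v \notin nbhd G u /\ w \notin nbhd G u,
        #|nbhd G u :\: nbhd G w| = 1%N &
        #|nbhd G u :\: nbhd G v| = 0%N].

Definition in_calC n (G : sgraph n) : Prop :=
  C_witness G \/ C_witness (compl G).

(* Main.v *)
(* Call G "leafy" when some leaf of G is adjacent to a vertex of degree >= 2.  By
   induction on the construction of G in R, a G outside C is alpha-robust
   unless G is leafy and beta-robust unless its complement is.  If no vertex is
   isolated in the complement, B has no zero row, so a generic combination of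
   the columns of B is a nowhere zero vector in ker A; this settles M.  By
   complementation it remains to treat unions.  A leafy part would put the
   union in C, so both parts are alpha-robust and block matrices make the union
   alpha-robust; for beta-robustness only an isolated vertex is an obstacle, and
   it is overcome by a rank one congruence of B.  Finally, a leafy G outside C
   has a dominating vertex next to its leaf, so G and its complement cannot both
   be leafy. *)
Require Import Defs.
From mathcomp Require Import all_boot all_order all_algebra.
From mathcomp Require Import reals.

Set Implicit Arguments.
Unset Strict Implicit.
Unset Printing Implicit Defensive.

Import GRing.Theory Num.Theory.
Local Open Scope ring_scope.

(** * Elementwise forms of leaves and of C-witnesses *)

(** The second neighbour [w] of [v] encodes degree at least 2, so no cardinal has to be transported
    between graphs. *)
Definition leaf_witness n (G : sgraph n) : Prop :=
  exists l v w : 'I_n,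
    [/\ adj G l v, forall x, adj G l x -> x = v, adj G v w & w != l].

Lemma leaf_witnessP n (G : sgraph n) :
  (exists l v : 'I_n, [/\ degree G l = 1%N, adj G l v & (2 <= degree G v)%N])
  <-> leaf_witness G.
Proof.
split=> [[l [v [/eqP/cards1P[x Nl] lv /card_gt1P[a [b [av bv ab]]]]]] |].
  have uniq_l y : adj G l y -> y = v.
    move=> ly; have: y \in nbhd G l by rewrite inE.
    have: v \in nbhd G l by rewrite inE.
    by rewrite Nl !inE => /eqP-> /eqP.
  rewrite !inE in av bv.
  have [al|al] := eqVneq a l; last by exists l, v, a.
  by exists l, v, b; split=> //; rewrite -al eq_sym.
move=> [l [v [w [lv uniq_l vw wl]]]]; exists l, v; split=> //.
  apply/eqP/cards1P; exists v; apply/setP=> x; rewrite !inE.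
  by apply/idP/eqP => [/uniq_l|->].
by apply/card_gt1P; exists w, l; rewrite !inE vw adj_sym lv wl.
Qed.

(** Naming the single element [k] of the first difference replaces both cardinality conditions by
    adjacency statements. *)
Lemma C_witnessP n (G : sgraph n) :
  C_witness G <->
  exists u v w k : 'I_n,
    [/\ [/\ u != v, u != w & v != w], ~~ adj G u v /\ ~~ adj G u w,
        adj G u k /\ ~~ adj G w k,
        forall x, adj G u x -> ~~ adj G w x -> x = k
      & forall x, adj G u x -> adj G v x].
Proof.
split=> [[u [v [w [d]]]]|[u [v [w [k [d [uv uw] [uk wk] uniq_k sub]]]]]].
  rewrite !inE => -[uv uw] /eqP/cards1P[k Nk] /eqP.
  rewrite cards_eq0 setD_eq0 => /subsetP sub; exists u, v, w, k; split=> //.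
  - have: k \in nbhd G u :\: nbhd G w by rewrite Nk set11.
    by rewrite !inE => /andP[].
  - move=> x ux wx; have: x \in nbhd G u :\: nbhd G w by rewrite !inE wx.
    by rewrite Nk inE => /eqP.
  - by move=> x ux; have := sub x; rewrite !inE; apply.
exists u, v, w; rewrite !inE; split=> //.
  apply/eqP/cards1P; exists k; apply/setP=> x; rewrite !inE.
  by apply/andP/eqP => [[wx ux]|->]; [apply: uniq_k|split].
by apply/eqP; rewrite cards_eq0 setD_eq0; apply/subsetP=> x; rewrite !inE; apply: sub.
Qed.

(** * Complements, isomorphisms and joins *)

Lemma adj_complK n (G : sgraph n) : adj (compl (compl G)) =2 adj G.
Proof.
move=> i j; rewrite /= /compl_rel /=.
by rewrite /compl_rel; case: eqVneq => [->|_]; rewrite ?adj_irr //= negbK.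
Qed.

Lemma isomorphic_complK n (G : sgraph n) : isomorphic (compl (compl G)) G.
Proof. by exists id => [|i j]; [exists id|rewrite adj_complK]. Qed.

Lemma isomorphic_sym m n (G : sgraph m) (H : sgraph n) :
  isomorphic G H -> isomorphic H G.
Proof.
move=> [f [g fK gK] fA]; exists g; first by exists f.
by move=> i j; rewrite -fA !gK.
Qed.

Lemma isomorphic_compl m n (G : sgraph m) (H : sgraph n) :
  isomorphic G H -> isomorphic (compl G) (compl H).
Proof.
move=> [f bij_f fA]; exists f => // i j.
by rewrite /= /compl_rel fA (inj_eq (bij_inj bij_f)).
Qed.

(** De Morgan duality, through which the join case of the induction follows from the union case. *)
Lemma isomorphic_join m n (G : sgraph m) (H : sgraph n) :
  isomorphic (compl (disj_union (compl G) (compl H))) (join G H).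
Proof.
exists id => [|i j]; first by exists id.
rewrite /= /compl_rel /= /sum_rel.
by have [a ->|a ->] := split_ordP i; have [b ->|b ->] := split_ordP j;
  rewrite ?(unsplitK (inl _)) ?(unsplitK (inr _)) /= /compl_rel
    ?eq_lshift ?eq_rshift ?eq_lrshift ?eq_rlshift //;
  case: eqVneq => [->|_]; rewrite ?adj_irr //= negbK.
Qed.

(** * Modules and the inheritance of C *)

(** A module in the sense of modular decomposition: no outside vertex distinguishes two vertices of
    the image. Isomorphisms and the parts of a union are instances. *)
Definition is_module m n (G : sgraph m) (K : sgraph n) (f : 'I_m -> 'I_n) :=
  [/\ injective f, forall i j, adj K (f i) (f j) = adj G i j
    & forall i j z, z \notin codom f -> adj K (f i) z = adj K (f j) z].

Lemma is_module_compl m n (G : sgraph m) (K : sgraph n) f :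
  is_module G K f -> is_module (compl G) (compl K) f.
Proof.
move=> [inj_f fA fM]; split=> // [i j|i j z zf]; rewrite /= /compl_rel.
  by rewrite fA (inj_eq inj_f).
rewrite (fM i j) //; congr (_ && _).
have fz y : f y != z by apply: contraNneq zf => <-; rewrite codom_f.
by rewrite !fz.
Qed.

(** An outside vertex is adjacent to all or none of [f u], [f v], [f w], hence adds nothing to
    either neighbourhood difference. *)
Lemma C_witness_module m n (G : sgraph m) (K : sgraph n) f :
  is_module G K f -> C_witness G -> C_witness K.
Proof.
move=> [inj_f fA fM] /C_witnessP[u [v [w [k [[uv uw vw] nadj [uk wk] uniq_k sub]]]]].
apply/C_witnessP; exists (f u), (f v), (f w), (f k).
rewrite !(inj_eq inj_f) !fA; split=> //.
- move=> x; have [/codomP[y ->]|xf] := boolP (x \in codom f).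
    by rewrite !fA => uy wy; congr f; apply: uniq_k.
  by rewrite (fM u w) // => ->.
- move=> x; have [/codomP[y ->]|xf] := boolP (x \in codom f).
    by rewrite !fA; apply: sub.
  by rewrite (fM u v).
Qed.

Lemma in_calC_module m n (G : sgraph m) (K : sgraph n) f :
  is_module G K f -> in_calC G -> in_calC K.
Proof.
move=> fM [CG|CG]; first by left; apply: C_witness_module fM CG.
by right; apply: C_witness_module (is_module_compl fM) CG.
Qed.

Lemma isomorphic_module m n (G : sgraph m) (H : sgraph n) :
  isomorphic G H -> exists f, is_module G H f.
Proof.
move=> [f bij_f fA]; exists f; split=> //; first exact: bij_inj.
move=> i j z; have [g fK gK] := bij_f.
by rewrite -[z]gK codom_f.
Qed.

Lemma in_calC_iso m n (G : sgraph m) (H : sgraph n) :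
  isomorphic G H -> in_calC G -> in_calC H.
Proof. by move=> /isomorphic_module[f fM]; apply: in_calC_module fM. Qed.

Lemma in_calC_compl n (G : sgraph n) : in_calC (compl G) -> in_calC G.
Proof.
have [f fM] := isomorphic_module (isomorphic_complK G).
by move=> [CG|CG]; [right|left; apply: C_witness_module fM CG].
Qed.

Lemma leaf_witness_iso m n (G : sgraph m) (H : sgraph n) :
  isomorphic G H -> leaf_witness G -> leaf_witness H.
Proof.
move=> [f [g fK gK] fA] [l [v [w [lv uniq_l vw wl]]]].
exists (f l), (f v), (f w); rewrite !fA (can_eq fK); split=> // x.
by rewrite -[x]gK fA => /uniq_l ->.
Qed.

Lemma disj_union_lshift m n (G : sgraph m) (H : sgraph n) :
  is_module G (disj_union G H) (lshift n).
Proof.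
split=> [|i j|i j z zf]; first exact: lshift_inj.
  by rewrite /= /sum_rel !(unsplitK (inl _)).
have [a za|a ->] := split_ordP z; first by rewrite za codom_f in zf.
by rewrite /= /sum_rel !(unsplitK (inl _)) (unsplitK (inr _)).
Qed.

Lemma disj_union_rshift m n (G : sgraph m) (H : sgraph n) :
  is_module H (disj_union G H) (@rshift m n).
Proof.
split=> [|i j|i j z zf]; first exact: rshift_inj.
  by rewrite /= /sum_rel !(unsplitK (inr _)).
have [a ->|a za] := split_ordP z; last by rewrite za codom_f in zf.
by rewrite /= /sum_rel !(unsplitK (inr _)) (unsplitK (inl _)).
Qed.

Lemma disj_union_lrshift m n (G : sgraph m) (H : sgraph n) i j :
  adj (disj_union G H) (lshift n i) (rshift m j) = false.
Proof. by rewrite /= /sum_rel (unsplitK (inl _)) (unsplitK (inr _)). Qed.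

(** * Leaves in graphs outside C *)

(** If [z] were not adjacent to [v], then [l], [w], [z] would be a C-witness: the only neighbour [v]
    of [l] is a neighbour of [w] but not of [z]. *)
Lemma leaf_nbr_dominating n (G : sgraph n) l v w :
  adj G l v -> (forall x, adj G l x -> x = v) -> adj G v w -> w != l ->
  ~ in_calC G -> forall z, z != v -> adj G v z.
Proof.
move=> lv uniq_l vw wl nC z zv; apply/negPn/negP => nvz.
have lz : ~~ adj G l z by apply: contra zv => /uniq_l ->.
have lw : ~~ adj G l w.
  by apply/negP => /uniq_l wv; rewrite wv adj_irr in vw.
apply: nC; left; apply/C_witnessP; exists l, w, z, v; split=> //.
- rewrite eq_sym wl; split=> //.
    by apply: contraNneq nvz => <-; rewrite adj_sym.
  by apply: contraNneq nvz => <-.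
- by split=> //; rewrite adj_sym.
- by move=> x /uniq_l.
- by move=> x /uniq_l ->; rewrite adj_sym.
Qed.

(** The vertex [v] dominates [G], so it is isolated in the complement, where [v'] dominates and has
    a neighbour. *)
Lemma leaf_witness_compl n (G : sgraph n) :
  ~ in_calC G -> leaf_witness G -> ~ leaf_witness (compl G).
Proof.
move=> nC [l [v [w [lv uniq_l vw wl]]]] [l' [v' [w' [lv' uniq_l' vw' wl']]]].
have dom := leaf_nbr_dominating lv uniq_l vw wl nC.
have dom' : forall z, z != v' -> adj (compl G) v' z.
  by apply: leaf_nbr_dominating lv' uniq_l' vw' wl' _ => /in_calC_compl.
have isol z : adj (compl G) v z = false.
  by rewrite /= /compl_rel; case: eqVneq => //= vz; rewrite dom // eq_sym.
have [v'v|/dom'] := eqVneq v v'; first by rewrite -v'v isol in vw'.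
by rewrite adj_sym isol.
Qed.

(** The neighbour of the leaf would dominate [K], yet it cannot reach [z] outside its own part. *)
Lemma leaf_witness_component m n (G : sgraph m) (K : sgraph n) f z :
  is_module G K f -> (forall i x, x \notin codom f -> ~~ adj K (f i) x) ->
  z \notin codom f -> ~ in_calC K -> ~ leaf_witness G.
Proof.
move=> [inj_f fA _] comp zf nC [l [v [w [lv uniq_l vw wl]]]].
have zv : z != f v by apply: contraNneq zf => ->; rewrite codom_f.
have uniq_fl x : adj K (f l) x -> x = f v.
  have [/codomP[y ->]|/comp/negPf-> //] := boolP (x \in codom f).
  by rewrite fA => /uniq_l ->.
apply: (negP (comp v z zf)).
by apply: (@leaf_nbr_dominating _ K (f l) (f v) (f w)); rewrite ?fA ?inj_eq.
Qed.

(** The first step of a path from [i] to any other vertex. *)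
Lemma connected_nbr n (G : sgraph n) :
  (1 < n)%N -> connected_graph G -> forall i, exists j, adj G i j.
Proof.
move=> n1 [_ conG] i.
have [k ki] : exists k : 'I_n, k != i.
  have : (0 < #|[set~ i]|)%N by rewrite cardsC1 card_ord -subn1 subn_gt0.
  by case/card_gt0P=> k; rewrite !inE; exists k.
have /connectP[[|j p] /=] := conG i k; first by move=> _ ki'; rewrite ki' eqxx in ki.
by case/andP=> ij _ _; exists j.
Qed.

(** * Transport of annihilating pairs along isomorphisms and complements *)

Section Vanishing.

Variable R : realType.

Lemma in_S_mxsub m n (G : sgraph m) (H : sgraph n) (g : 'I_n -> 'I_m)
    (A : 'M[R]_m) :
  injective g -> (forall i j, adj G (g i) (g j) = adj H i j) ->
  in_S G A -> in_S H (mxsub g g A).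
Proof.
move=> inj_g gA [symA patA]; split; first by rewrite trmx_mxsub symA.
by move=> i j ij; rewrite mxE -gA; apply: patA; rewrite inj_eq.
Qed.

Lemma mulmx_mxsub_bij m n p q (A : 'M[R]_(p, m)) (B : 'M[R]_(m, q)) p' q'
    (e : 'I_p' -> 'I_p) (h : 'I_q' -> 'I_q) (g : 'I_n -> 'I_m) :
  bijective g -> mxsub e g A *m mxsub g h B = mxsub e h (A *m B).
Proof.
move=> bij_g; apply/matrixP=> i j; rewrite !mxE.
rewrite (reindex g) /=; last exact: onW_bij.
by apply: eq_bigr => k _; rewrite !mxE.
Qed.

Lemma alpha_robust_iso m n (G : sgraph m) (H : sgraph n) :
  isomorphic G H -> alpha_robust R G -> alpha_robust R H.
Proof.
move=> iso; have [g bij_g gA] := isomorphic_sym iso.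
move=> [A [B [SA SB AB [x Ax x0]]]].
have inj_g := bij_inj bij_g.
exists (mxsub g g A), (mxsub g g B); split.
- exact: in_S_mxsub SA.
- apply: in_S_mxsub SB => // i j.
  by rewrite /= /compl_rel gA (inj_eq inj_g).
- by rewrite mulmx_mxsub_bij // AB; apply/matrixP=> i j; rewrite !mxE.
exists (mxsub g id x); last by move=> i; rewrite mxE.
by rewrite mulmx_mxsub_bij // Ax; apply/matrixP=> i j; rewrite !mxE.
Qed.

Lemma in_S_complK n (G : sgraph n) (A : 'M[R]_n) :
  in_S (compl (compl G)) A <-> in_S G A.
Proof.
by split=> -[symA patA]; split=> // i j /patA; rewrite adj_complK.
Qed.

Lemma mulmx_sym0 n (A B : 'M[R]_n) :
  A^T = A -> B^T = B -> A *m B = 0 -> B *m A = 0.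
Proof. by move=> sA sB AB; rewrite -[LHS]trmxK trmx_mul sA sB AB trmx0. Qed.

Lemma compl_vanishing_compl n (G : sgraph n) :
  compl_vanishing R G -> compl_vanishing R (compl G).
Proof.
move=> [A [B [SA SB AB]]]; exists B, A; split=> //.
  exact/in_S_complK.
by case: SA SB => sA _ [sB _]; apply: mulmx_sym0.
Qed.

Lemma alpha_robust_compl n (G : sgraph n) :
  alpha_robust R (compl G) <-> beta_robust R G.
Proof.
split=> -[A [B [SA SB AB [x Ax x0]]]]; exists B, A.
  split=> //; [exact/in_S_complK| |by exists x].
  by case: SA SB => sA _ [sB _]; apply: mulmx_sym0.
split=> //; [exact/in_S_complK| |by exists x].
by case: SA SB => sA _ [sB _]; apply: mulmx_sym0.
Qed.

(** * Generic vectors in kernels *)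

Lemma exists_nonroot (p : {poly R}) : p != 0 -> exists t, ~~ root p t.
Proof.
move=> p0; pose s := [seq k%:R : R | k <- iota 0 (size p)].
have [/(max_poly_roots p0)|/allPn[t _ pt]] := boolP (all (root p) s); last by exists t.
rewrite size_map size_iota ltnn map_inj_uniq ?iota_uniq; first by move/(_ isT).
exact: mulrIn (oner_neq0 R).
Qed.

(* Evaluate the rows, read as polynomials, along the moment curve (1, t, t^2, ..). *)
Lemma generic_nowhere_zero m n (M : 'M[R]_(m, n)) :
  (forall i, row i M != 0) -> exists z : 'cV[R]_n, forall i, (M *m z) i 0 != 0.
Proof.
move=> M0; pose p := \prod_i rVpoly (row i M).
have p0 : p != 0.
  apply/prodf_neq0 => i _; apply: contraNneq (M0 i) => /(congr1 (@poly_rV _ n)).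
  by rewrite rVpolyK linear0 => ->.
have [t pt] := exists_nonroot p0; exists (\col_k t ^+ k) => i.
move: pt; rewrite rootE horner_prod => /prodf_neq0/(_ i isT).
rewrite mxE (@horner_coef_wide _ n) ?size_poly //; congr (_ != 0).
by apply: eq_bigr => k _; rewrite coef_rVpoly_ord !mxE.
Qed.

Lemma generic_kernel n (G : sgraph n) (A B : 'M[R]_n) :
  (forall i, exists j, adj (compl G) i j) -> in_S (compl G) B -> A *m B = 0 ->
  ker_has_nowhere_zero A.
Proof.
move=> nbr [_ pB] AB; have [|z Bz] := @generic_nowhere_zero _ _ B.
  move=> i; have [j ij] := nbr i.
  have inj : i != j by apply: contraTneq ij => ->; rewrite adj_irr.
  apply/eqP => /matrixP/(_ 0 j)/eqP; rewrite !mxE; apply/negP.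
  exact/(pB _ _ inj).
by exists (B *m z); rewrite // mulmxA AB mul0mx.
Qed.

(** * Obstructions to vanishing and to alpha-robustness *)

(** Entry (u, v) of [A *m B] reduces to [A u u * B u v], which forces [A u u = 0]. Entry (u, w) then
    reduces to [A u k * B k w], a product of nonzero factors. *)
Lemma C_witness_not_vanishing n (G : sgraph n) :
  C_witness G -> ~ compl_vanishing R G.
Proof.
move=> /C_witnessP[u [v [w [k [[uv uw vw] [nuv nuw] [uk wk] uniq_k sub]]]]].
move=> [A [B [[sA pA] [sB pB] AB]]].
have A0 i j : i != j -> ~~ adj G i j -> A i j = 0.
  by move=> ij nij; apply/eqP/negPn/negP => /(pA _ _ ij); apply/negP.
have B0 i j : adj G i j -> B i j = 0.
  move=> aij; have ij : i != j by apply: contraTneq aij => ->; rewrite adj_irr.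
  by apply/eqP/negPn/negP => /(pB _ _ ij); rewrite /= /compl_rel aij andbF.
have Bn i j : i != j -> ~~ adj G i j -> B i j != 0.
  by move=> ij nij; apply/(pB _ _ ij); rewrite /= /compl_rel ij.
have Auu : A u u = 0.
  have /matrixP/(_ u v) := AB; rewrite !mxE (bigD1 u) //= big1 ?addr0.
    by move/eqP; rewrite mulf_eq0 (negPf (Bn _ _ uv nuv)) orbF => /eqP.
  move=> x xu; have [ux|nux] := boolP (adj G u x).
    by rewrite B0 ?mulr0 // adj_sym sub.
  by rewrite A0 ?mul0r // eq_sym.
have ku : k != u by apply: contraTneq uk => ->; rewrite adj_irr.
have kw : k != w by apply: contraTneq uk => ->.
have /matrixP/(_ u w) := AB; rewrite !mxE (bigD1 k) //= big1 ?addr0.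
  move/eqP; rewrite mulf_eq0 => /orP[]; apply/negP.
    by apply/(pA u k); rewrite // eq_sym.
  by apply: Bn; rewrite // adj_sym.
move=> x xk; have [->|xu] := eqVneq x u; first by rewrite Auu mul0r.
have [ux|nux] := boolP (adj G u x); last by rewrite A0 ?mul0r // eq_sym.
rewrite B0 ?mulr0 // adj_sym; apply/negPn/negP => nwx.
by rewrite (uniq_k x) ?eqxx in xk.
Qed.

(** Row [l] of [A] lives on [l] and [v], so a nowhere zero kernel vector forces [A l l] to be
    nonzero. Then entry (l, w) of [A *m B] is [A l l * B l w], which is nonzero. *)
Lemma leaf_witness_not_alpha n (G : sgraph n) :
  leaf_witness G -> ~ alpha_robust R G.
Proof.
move=> [l [v [w [lv uniq_l vw wl]]]] [A [B [[sA pA] [sB pB] AB [x Ax x0]]]].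
have lv' : l != v by apply: contraTneq lv => ->; rewrite adj_irr.
have A0 j : j != l -> j != v -> A l j = 0.
  rewrite eq_sym => lj jv; apply/eqP/negPn/negP => /(pA _ _ lj)/uniq_l.
  exact/eqP.
have rowl p (C : 'M[R]_(n, p)) k : (A *m C) l k = A l l * C l k + A l v * C v k.
  rewrite mxE (bigD1 l) //= (bigD1 v) 1?eq_sym //= big1 ?addr0 //.
  by move=> j /andP[jl jv]; rewrite A0 ?mul0r.
have All : A l l != 0.
  have /matrixP/(_ l 0) := Ax; rewrite rowl mxE => /eqP.
  apply: contraTneq => ->; rewrite mul0r add0r mulf_neq0 //.
  exact/(pA _ _ lv').
have Bvw : B v w = 0.
  have vw' : v != w by apply: contraTneq vw => ->; rewrite adj_irr.
  by apply/eqP/negPn/negP => /(pB _ _ vw'); rewrite /= /compl_rel vw andbF.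
have /matrixP/(_ l w) := AB; rewrite rowl Bvw mulr0 addr0 mxE => /eqP.
rewrite mulf_eq0 (negPf All) /=; apply/negP; apply/(pB l w); first by rewrite eq_sym.
rewrite /= /compl_rel eq_sym wl; apply/negP => /uniq_l wv.
by rewrite wv adj_irr in vw.
Qed.

(** * Robustness of unions, edgeless graphs and graphs with an isolated vertex *)

(* If A x = 0 and A' x' = 0 then the off-diagonal block x x'^T of B is killed
   on both sides. *)
Lemma alpha_robust_disj_union m n (G : sgraph m) (H : sgraph n) :
  alpha_robust R G -> alpha_robust R H -> alpha_robust R (disj_union G H).
Proof.
move=> [A [B [[sA pA] [sB pB] AB [x Ax x0]]]].
move=> [A' [B' [[sA' pA'] [sB' pB'] AB' [x' Ax' x0']]]].
exists (block_mx A 0 0 A'), (block_mx B (x *m x'^T) (x' *m x^T) B'); split.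
- split; first by rewrite tr_block_mx sA sA' !trmx0.
  move=> i j; rewrite /= /sum_rel.
  have [a ->|a ->] := split_ordP i; have [b ->|b ->] := split_ordP j;
    rewrite ?(unsplitK (inl _)) ?(unsplitK (inr _))
      ?eq_lshift ?eq_rshift ?eq_lrshift ?eq_rlshift
      ?block_mxEul ?block_mxEur ?block_mxEdl ?block_mxEdr ?mxE ?eqxx.
  + exact: pA.
  + by [].
  + by [].
  + exact: pA'.
- split; first by rewrite tr_block_mx sB sB' !trmx_mul !trmxK.
  move=> i j; rewrite /= /compl_rel /= /sum_rel.
  have [a ->|a ->] := split_ordP i; have [b ->|b ->] := split_ordP j;
    rewrite ?(unsplitK (inl _)) ?(unsplitK (inr _))
      ?eq_lshift ?eq_rshift ?eq_lrshift ?eq_rlshift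
      ?block_mxEul ?block_mxEur ?block_mxEdl ?block_mxEdr.
  + exact: pB.
  + by rewrite mxE big_ord1 mxE mulf_neq0.
  + by rewrite mxE big_ord1 mxE mulf_neq0.
  + exact: pB'.
- rewrite mulmx_block !mul0mx !addr0 !add0r !mulmxA Ax Ax' !mul0mx AB AB'.
  by rewrite block_mx0.
exists (col_mx x x'); first by rewrite mul_block_col !mul0mx addr0 add0r Ax Ax' col_mx0.
by move=> i; have [a ->|a ->] := split_ordP i; rewrite ?col_mxEu ?col_mxEd.
Qed.

Lemma edgeless_robust n (G : sgraph n) :
  (forall i j, ~~ adj G i j) -> alpha_robust R G /\ beta_robust R G.
Proof.
(* The diagonal shift by [n] makes every row sum zero, so the all-ones vector lies in the kernel of
   [B]. *)
move=> nG; pose B : 'M[R]_n := const_mx 1 - n%:R%:M.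
have S0 : in_S G (0 : 'M[R]_n).
  split; first by rewrite trmx0.
  by move=> i j _; rewrite mxE eqxx (negPf (nG i j)).
have SB : in_S (compl G) B.
  split; first by rewrite linearB /= trmx_const tr_scalar_mx.
  move=> i j ij; rewrite !mxE (negPf ij) subr0 oner_neq0.
  by rewrite /= /compl_rel ij (negPf (nG i j)).
split; exists 0, B; rewrite mul0mx; split=> //; exists (const_mx 1).
- by rewrite mul0mx.
- by move=> i; rewrite mxE oner_neq0.
- rewrite mulmxBl mul_scalar_mx; apply/matrixP=> i j; rewrite !mxE mulr1.
  under eq_bigr do rewrite !mxE mulr1.
  by rewrite sumr_const card_ord subrr.
- by move=> i; rewrite mxE oner_neq0.
Qed.

(* With P = 1 - w e_i^T and w i = 1, the congruence P^T B P only changes row and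
   column i of B, and A still annihilates it because column i of A is zero; it
   kills w since P w = 0.  A generic w keeps row i nonzero off the diagonal. *)
Lemma isolated_beta n (G : sgraph n) i :
  (forall j, ~~ adj G i j) ->
  (forall j, j != i -> exists2 k, k != i & adj (compl G) j k) ->
  alpha_robust R G -> beta_robust R G.
Proof.
move=> isol nbr [A [B [[sA pA] [sB pB] AB [x Ax x0]]]].
have A0 j : j != i -> A i j = 0.
  rewrite eq_sym => ij; apply/eqP/negPn/negP => /(pA _ _ ij).
  exact/negP/isol.
have Aii : A i i = 0.
  have /matrixP/(_ i 0) := Ax; rewrite !mxE (bigD1 i) //= big1 ?addr0.
    by move/eqP; rewrite mulf_eq0 (negPf (x0 i)) orbF => /eqP.
  by move=> j ji; rewrite A0 ?mul0r.
pose e : 'rV[R]_n := delta_mx 0 i.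
have Ae : A *m e^T = 0.
  apply/colP=> j; rewrite trmx_delta -colE !mxE -sA mxE.
  by have [->|/A0] := eqVneq j i.
(* [C] is [B] with row and column [i] replaced by those of the identity. Stacking the identity on
   top of it makes one generic vector nowhere zero both itself and after applying [C]. *)
pose C : 'M[R]_n := \matrix_(j, k)
  if j == i then (k == i)%:R else if k == i then 0 else B j k.
have [|w0 w0P] := @generic_nowhere_zero _ _ (col_mx 1%:M C).
  move=> j; have [a ->|a ->] := split_ordP j; apply/eqP=> /rowP rowj0.
    have := rowj0 a; rewrite !mxE (unsplitK (inl _)) !mxE eqxx => /eqP.
    exact/negP/oner_neq0.
  have [ai|ai] := eqVneq a i.
    have := rowj0 i; rewrite !mxE (unsplitK (inr _)) !mxE ai !eqxx => /eqP.
    exact/negP/oner_neq0.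
  have [k ki ak] := nbr a ai.
  have := rowj0 k; rewrite !mxE (unsplitK (inr _)) !mxE (negPf ai) (negPf ki).
  move/eqP; apply/negP; apply/(pB a k) => //.
  by apply: contraTneq ak => ->; rewrite adj_irr.
have w0n j : w0 j 0 != 0.
  by have := w0P (lshift n j); rewrite mul_col_mx col_mxEu mul1mx.
have Cw0 j : (C *m w0) j 0 != 0.
  by have := w0P (rshift n j); rewrite mul_col_mx col_mxEd.
pose w := (w0 i 0)^-1 *: w0.
have wn j : w j 0 != 0 by rewrite mxE mulf_neq0 ?invr_eq0.
have Cw j : (C *m w) j 0 != 0 by rewrite -scalemxAr mxE mulf_neq0 ?invr_eq0.
have ew : e *m w = 1%:M.
  apply/matrixP=> a b; rewrite !ord1 -rowE !mxE eqxx mulVf //.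
pose P : 'M[R]_n := 1%:M - w *m e.
have Pw : P *m w = 0 by rewrite mulmxBl mul1mx -mulmxA ew mulmx1 subrr.
have PT : P^T = 1%:M - e^T *m w^T by rewrite linearB /= trmx1 trmx_mul.
have AP : A *m P^T = A by rewrite PT mulmxBr mulmx1 mulmxA Ae mul0mx subr0.
have sB' : (P^T *m B *m P)^T = P^T *m B *m P.
  by rewrite !trmx_mul trmxK sB mulmxA.
have B'E j k : j != i ->
    (P^T *m B *m P) j k = B j k - (B *m w) j 0 * (k == i)%:R.
  move=> ji; rewrite -mulmxA PT mulmxBl mul1mx -mulmxA mxE [X in _ + X]mxE.
  rewrite [X in _ - X]mxE big_ord1 [e^T j 0]mxE [e 0 j]mxE (negPf ji) andbF.
  rewrite mul0r subr0.
  rewrite mulmxBr mulmx1 mulmxA mxE [X in _ + X]mxE [X in _ - X]mxE.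
  by rewrite big_ord1 [e 0 k]mxE eqxx.
have B'i j : j != i -> (P^T *m B *m P) j i != 0.
  move=> ji; rewrite B'E // eqxx mulr1 -opprB oppr_eq0.
  (* As [w i = 1], the summand of index [i] in [B *m w] cancels [B j i], and row [j] of [C] keeps
     exactly the others. *)
  suff -> : (B *m w) j 0 - B j i = (C *m w) j 0 by [].
  have wi : w i 0 = 1 by rewrite mxE mulVf.
  rewrite !mxE (bigD1 i) //= wi mulr1 addrAC subrr add0r.
  rewrite [RHS](bigD1 i) //= !mxE (negPf ji) eqxx mul0r add0r.
  by apply: eq_bigr => k ki; rewrite !mxE (negPf ji) (negPf ki).
exists A, (P^T *m B *m P); split=> //.
- split=> // j k jk; have [ji|ji] := eqVneq j i.
    have ki : k != i by rewrite -ji eq_sym.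
    by rewrite ji -sB' mxE B'i // /= /compl_rel eq_sym ki isol.
  have [->|ki] := eqVneq k i; last first.
    by rewrite B'E // (negPf ki) mulr0 subr0; apply: pB.
  by rewrite B'i // /= /compl_rel ji adj_sym isol.
- by rewrite !mulmxA AP AB mul0mx.
- by exists w; rewrite // -mulmxA Pw mulmx0.
Qed.

(** With an isolated vertex [i], [isolated_beta] fails to apply only if some [j] has [i] as its sole
    neighbour in the complement; then [j] is a leaf there, which is excluded. *)
Lemma beta_of_alpha n (G : sgraph n) :
  ~ leaf_witness (compl G) -> alpha_robust R G -> beta_robust R G.
Proof.
move=> nleaf alphaG.
have [/existsP[i /forallP isol]|/existsPn nisol] :=
  boolP [exists i, forall j, ~~ adj G i j]; last first.
  have [A [B [SA SB AB _]]] := alphaG; exists A, B; split=> //.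
  apply: (@generic_kernel _ (compl G) B A); last 2 first.
  - exact/in_S_complK.
  - by case: SA SB => sA _ [sB _]; apply: mulmx_sym0.
  by move=> i; have /forallPn[j] := nisol i; rewrite negbK -adj_complK; exists j.
(* The edgeless case is separate because an edge [a b] is what later provides a second neighbour of
   [i] in the complement, distinct from [j]. *)
have [nG|/forallPn[a /forallPn[b]]] := boolP [forall a, forall b, ~~ adj G a b].
  by have [] // := edgeless_robust (G := G) => a b; have /forallP/(_ a)/forallP := nG.
rewrite negbK => ab; apply: (isolated_beta isol _ alphaG) => j ji.
have [/existsP[k /andP[]]|/existsPn nk] :=
  boolP [exists k, (k != i) && adj (compl G) j k]; first by exists k.
have adj_i k : k != i -> adj (compl G) i k.
  by move=> ki; rewrite /= /compl_rel eq_sym ki isol.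
case: nleaf; have [w wi wj] : exists2 w, w != i & w != j.
  have ai : a != i by apply: contraTneq ab => ->.
  have bi : b != i by apply: contraTneq ab => ->; rewrite adj_sym.
  have [aj|] := eqVneq a j; last by exists a.
  by exists b; rewrite // -aj; apply: contraTneq ab => ->; rewrite adj_irr.
exists j, i, w; split=> //; last exact: adj_i.
  by rewrite adj_sym adj_i.
by move=> k jk; apply/eqP; have := nk k; rewrite jk andbT negbK.
Qed.

(** * Induction on the construction of R *)

(** Each part of a union must offer a vertex outside the other, as [leaf_witness_component]
    requires. *)
Lemma in_calR_gt0 n (G : sgraph n) : in_calR R G -> (0 < n)%N.
Proof.
elim=> {n G} [n G [_ [] //]|m n G H _ m0 _ _|m n G H _ m0 _ _|//|m n G H].
- by rewrite addn_gt0 m0.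
- by rewrite addn_gt0 m0.
by move=> [f _ _] _ m0; have := ltn_ord (f (Ordinal m0)); apply: leq_ltn_trans.
Qed.

(** The invariant of the induction; complementation exchanges its two clauses. *)
Definition robust_or_leaf n (G : sgraph n) : Prop :=
  ~ in_calC G ->
  (~ leaf_witness G -> alpha_robust R G) /\
  (~ leaf_witness (compl G) -> beta_robust R G).

Lemma robust_or_leaf_iso m n (G : sgraph m) (H : sgraph n) :
  isomorphic G H -> robust_or_leaf G -> robust_or_leaf H.
Proof.
move=> iso robG nC; have [|alphaG betaG] := robG.
  by apply: contra_not nC; apply: in_calC_iso.
split=> nleaf.
  apply: (alpha_robust_iso iso); apply: alphaG.
  by apply: contra_not nleaf; apply: leaf_witness_iso.
have isoC := isomorphic_compl iso.
apply/alpha_robust_compl/(alpha_robust_iso isoC)/alpha_robust_compl/betaG.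
by apply: contra_not nleaf; apply: leaf_witness_iso.
Qed.

Lemma robust_or_leaf_compl n (G : sgraph n) :
  robust_or_leaf G -> robust_or_leaf (compl G).
Proof.
move=> robG nC; have isoK := isomorphic_sym (isomorphic_complK G).
have [|alphaG betaG] := robG.
  apply: contra_not nC => CG; apply: in_calC_compl.
  exact: in_calC_iso isoK CG.
split=> nleaf; first exact/alpha_robust_compl/betaG.
apply/alpha_robust_compl/(alpha_robust_iso isoK)/alphaG.
by apply: contra_not nleaf; apply: leaf_witness_iso.
Qed.

Lemma robust_or_leaf_union m n (G : sgraph m) (H : sgraph n) :
  (0 < m)%N -> (0 < n)%N -> robust_or_leaf G -> robust_or_leaf H ->
  robust_or_leaf (disj_union G H).
Proof.
move=> m0 n0 robG robH nC.
have modG := disj_union_lshift G H; have modH := disj_union_rshift G H.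
have [|alphaG _] := robG; first by apply: contra_not nC; apply: in_calC_module modG.
have [|alphaH _] := robH; first by apply: contra_not nC; apply: in_calC_module modH.
have alphaGH : alpha_robust R (disj_union G H).
  apply: alpha_robust_disj_union.
    apply: alphaG; apply: (leaf_witness_component (z := rshift m (Ordinal n0)) modG _ _ nC)
      => [i x xG|].
      have [a xa|a ->] := split_ordP x; first by rewrite xa codom_f in xG.
      by rewrite disj_union_lrshift.
    by apply/codomP => -[a] /eqP; rewrite eq_rlshift.
  apply: alphaH; apply: (leaf_witness_component (z := lshift n (Ordinal m0)) modH _ _ nC)
    => [i x xH|].
    have [a ->|a xa] := split_ordP x; last by rewrite xa codom_f in xH.
    by rewrite adj_sym disj_union_lrshift.
  by apply/codomP => -[a] /eqP; rewrite eq_lrshift.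
by split=> // nleaf; apply: beta_of_alpha.
Qed.

Lemma robust_or_leaf_calM n (G : sgraph n) : in_calM R G -> robust_or_leaf G.
Proof.
move=> [[A [B [SA SB AB]]] conG conCG] _.
(* A single vertex is connected without having a neighbour, so it escapes the generic kernel
   argument. *)
have [n1|n1] := leqP n 1.
  suff [] : alpha_robust R G /\ beta_robust R G by [].
  apply: edgeless_robust => i j; have -> : i = j; last by rewrite adj_irr.
  apply: ord_inj; move: (ltn_ord i) (ltn_ord j).
  by case: n n1 {G A B SA SB AB conG conCG} i j => [|[|n]] //= _ [[|i] ?] [[|j] ?].
split=> _; exists A, B; split=> //.
  exact: generic_kernel (connected_nbr n1 conCG) SB AB.
apply: (@generic_kernel _ (compl G) B A).
- by move=> i; have [j ij] := connected_nbr n1 conG i; exists j; rewrite adj_complK.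
- exact/in_S_complK.
- by case: SA SB => sA _ [sB _]; apply: mulmx_sym0.
Qed.

Lemma in_calR_robust_or_leaf n (G : sgraph n) :
  in_calR R G -> robust_or_leaf G.
Proof.
elim=> {n G} [n G|m n G H RG robG RH robH|m n G H RG robG RH robH|n G _|m n G H iso _].
- exact: robust_or_leaf_calM.
- by apply: robust_or_leaf_union => //; apply: in_calR_gt0; eassumption.
- apply: (robust_or_leaf_iso (isomorphic_join G H)).
  apply/robust_or_leaf_compl/robust_or_leaf_union; try exact: robust_or_leaf_compl.
    exact: in_calR_gt0 RG.
  exact: in_calR_gt0 RH.
- exact: robust_or_leaf_compl.
- exact: robust_or_leaf_iso.
Qed.

End Vanishing.

Theorem theorem3p8 (R : realType) (n : nat) (G : sgraph n)
    (hG : in_calR R G) :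
  [/\ in_calC G -> ~ compl_vanishing R G,
      ~ in_calC G -> in_calD R G -> beta_robust R G /\ ~ alpha_robust R G,
      ~ in_calC G -> in_calD R (compl G) ->
        alpha_robust R G /\ ~ beta_robust R G
    & ~ in_calC G -> ~ in_calD R G -> ~ in_calD R (compl G) ->
        alpha_robust R G /\ beta_robust R G].
Proof.
have rob := in_calR_robust_or_leaf hG.
split=> [[CG|CG]|nC [_ /leaf_witnessP leafG]|nC [_ /leaf_witnessP leafG]|nC nD nD'].
- exact: C_witness_not_vanishing.
- by move/compl_vanishing_compl; apply: C_witness_not_vanishing.
- split; last exact: leaf_witness_not_alpha.
  (* The leaf in [G] rules out one in the complement, which opens the beta clause of the
     invariant. *)
  by apply: (rob nC).2; apply: leaf_witness_compl.
- split; last by move/alpha_robust_compl; apply: leaf_witness_not_alpha.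
  by apply: (rob nC).1 => leafG'; apply: (leaf_witness_compl nC leafG').
split; first by apply: (rob nC).1 => /leaf_witnessP leafG; apply: nD.
by apply: (rob nC).2 => /leaf_witnessP leafG; apply: nD'; split=> //; apply: calR_compl.
Qed.
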